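(* Fix $0<a\le b$. There are constants $A>0$ and $N_0\in\mathbb N$ depending only on $a,b$ such that for every $N\ge N_0$, every $\mu\in\mathcal M_{a,b,N^{-1}}(\mathbb T^N)$ that is a probability measure, every $g\in\mathcal O_{N^{-1}}(\mathbb T^N)$ and every $\epsilon>0$, $$\mu\big(|g-\mathbb E_\mu[g]|\ge\epsilon\big)\le2\exp\Big[-\frac{\epsilon^2N}{(1+A N^{-1})^2}\Big].$$
   Context: $\mathbb T=\mathbb R/\mathbb Z$ with torus distance. $\mathcal V_a:=\{\psi\in C^2(\mathbb T,(0,\infty)):|\frac d{dx}\log\psi(x)|<a\ \forall x\}$; for $\psi_1,\psi_2\in\mathcal V_a$, $\beta_a(\psi_1,\psi_2):=\inf\{t>0:t\psi_1-\psi_2\in\mathcal V_a\}$, $\theta_a:=\log\beta_a(\psi_1,\psi_2)+\log\beta_a(\psi_2,\psi_1)$. For $\boldsymbol x\in\mathbb T^N$, $\hat{\boldsymbol x}_i$ is $\boldsymbol x$ without its $i$-th coordinate and $\boldsymbol x=(x_i;\hat{\boldsymbol x}_i)$. For a measure $\mu$ on $\mathbb T^N$ with density $\rho\in C^2(\mathbb T^N,(0,\infty))$, $\rho_{\hat{\boldsymbol x}_i}(x):=\rho(x;\hat{\boldsymbol x}_i)/\int\rho(s;\hat{\boldsymbol x}_i)ds$. $\mu\in\mathcal M_{a,b,L}$ iff for every $i$: $\rho_{\hat{\boldsymbol x}_i}\in\mathcal V_a$ for all $\hat{\boldsymbol x}_i$, and $\theta_b(\rho_{\hat{\boldsymbol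 x}_i},\rho_{\hat{\boldsymbol x}'_i})\le L|x_j-x'_j|$ whenever $\hat{\boldsymbol x}_i,\hat{\boldsymbol x}'_i$ differ only in some coordinate $j\neq i$ (values $x_j,x_j'$). Oscillation: for $\psi:\mathbb T^k\to\mathbb R$, $\mathrm{Osc}_j\psi:=\sup\{|\psi(x_j;\hat{\boldsymbol x}_j)-\psi(x_j';\hat{\boldsymbol x}_j)|:x_j,x_j'\in\mathbb T,\hat{\boldsymbol x}_j\in\mathbb T^{k-1}\}$, and $\mathcal O_\alpha(\mathbb T^k):=\{\psi\in L^1(\mathbb T^k):\mathrm{Osc}_j\psi\le\alpha\ \forall j\in[1,k]\}$. *)

(* Defs.v *)
From HB Require Import structures.
From mathcomp Require Import all_boot all_order all_algebra.
From mathcomp Require Import all_classical all_reals all_analysis.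
Set Implicit Arguments. Unset Strict Implicit. Unset Printing Implicit Defensive.
Import Order.TTheory GRing.Theory Num.Theory.
Import numFieldNormedType.Exports.
Local Open Scope classical_set_scope.
Local Open Scope ring_scope.

Section Defs.
Variable R : realType.

(* torus distance on T = R/Z, points represented by reals *)
Definition tdist (x y : R) : R :=
  let z := (x - y) - (Num.floor (x - y))%:~R in Num.min z (1 - z).

Definition ins n (i : 'I_n) (x : R) (t : n.-tuple R) : n.-tuple R :=
  [tuple (if j == i then x else tnth t j) | j < n].

Definition periodic1 (f : R -> R) := forall x, f (x + 1) = f x.

Definition C2_1 (f : R -> R) :=
  [/\ continuous f, (forall x, derivable f x 1), continuous (derive1 f),
      (forall x, derivable (derive1 f) x 1) & continuous (derive1 (derive1 f))].

Definition Vset (a : R) (psi : R -> R) : Prop :=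
  [/\ periodic1 psi, C2_1 psi, (forall x, 0 < psi x)
    & forall x, `| derive1 (fun y => ln (psi y)) x | < a].

Definition beta_a (a : R) (psi1 psi2 : R -> R) : R :=
  inf [set t : R | 0 < t /\ Vset a (fun x => t * psi1 x - psi2 x)].

Definition theta_a (a : R) (psi1 psi2 : R -> R) : R :=
  ln (beta_a a psi1 psi2) + ln (beta_a a psi2 psi1).

Definition periodicN n (f : n.-tuple R -> R) :=
  forall (i : 'I_n) t, f (ins i (tnth t i + 1) t) = f t.

Definition contN n (f : n.-tuple R -> R) :=
  forall t (e : R), 0 < e -> exists2 d : R, 0 < d &
    forall t', (forall j, `|tnth t' j - tnth t j| < d) -> `|f t' - f t| < e.

Definition has_partial n (i : 'I_n) (f : n.-tuple R -> R) :=
  forall t, derivable (fun x => f (ins i x t)) (tnth t i) 1.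

Definition partial n (i : 'I_n) (f : n.-tuple R -> R) : n.-tuple R -> R :=
  fun t => derive1 (fun x => f (ins i x t)) (tnth t i).

Definition C2_N n (f : n.-tuple R -> R) :=
  contN f /\ forall i : 'I_n, [/\ has_partial i f, contN (partial i f)
     & forall j : 'I_n, has_partial j (partial i f) /\
                        contN (partial j (partial i f))].

Definition int01 (f : R -> R) : R :=
  fine (\int[lebesgue_measure]_(s in `[0%R, 1%R]) (f s)%:E)%E.

Fixpoint iterint (n : nat) : (n.-tuple R -> \bar R) -> \bar R :=
  match n as m return ((m.-tuple R -> \bar R) -> \bar R) with
  | 0 => fun f => f [tuple]
  | m.+1 => fun f => (\int[lebesgue_measure]_(x in `[0%R, 1%R])
                        iterint (fun t : m.-tuple R => f (cons_tuple x t)))%E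
  end.

(* conditional density rho_{\hat x_i}; \hat x_i is given by a full tuple t whose
   i-th coordinate is ignored *)
Definition cond_dens n (rho : n.-tuple R -> R) (i : 'I_n) (t : n.-tuple R)
  : R -> R :=
  fun x => rho (ins i x t) / int01 (fun s => rho (ins i s t)).

Definition Mclass n (a b L : R) (rho : n.-tuple R -> R) : Prop :=
  [/\ periodicN rho, C2_N rho, (forall t, 0 < rho t) &
    forall i : 'I_n,
      (forall t, Vset a (cond_dens rho i t)) /\
      (forall (j : 'I_n) (t t' : n.-tuple R), j != i ->
         (forall k : 'I_n, k != j -> tnth t k = tnth t' k) ->
         theta_a b (cond_dens rho i t) (cond_dens rho i t')
           <= L * tdist (tnth t j) (tnth t' j))].

Definition Osc n (j : 'I_n) (psi : n.-tuple R -> R) : \bar R :=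
  ereal_sup [set e : \bar R | exists (x x' : R) (t : n.-tuple R),
               e = (`|psi (ins j x t) - psi (ins j x' t)|)%:E].

End Defs.

(* Main.v *)
(** The bound on [theta_b] is used only through the Hilbert projective metric:
    since [tdist <= 1/2], changing the coordinate [j] changes the ratio of two
    values of a conditional density of another coordinate by a factor at most
    [K = exp (1/(2N))].  This is a symmetric "cross-ratio" condition on pairs of
    coordinates, and it is almost preserved when the last coordinate is
    integrated out: [K] becomes at most [K (1 + (K-1)^2/2)], so that all the
    marginals keep [K - 1 = O(1/N)].  Integrating [exp (lam g) rho] one
    coordinate at a time, Hoeffding's lemma bounds each step by
    [exp (lam g' + lam^2 c^2/8)] where [g'] is the conditional mean of [g];
    comparing two conditional densities shows that the oscillations of [g'] are
    at most [c (1 + (K-1)/2)].  After [N] steps [c] has grown from [1/N] to at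
    most [1.41/N]; as [1.41^2 < 2], the factor 2 between the exponent
    [2 eps^2 N] of McDiarmid's inequality and [eps^2 N] absorbs the growth, so
    the theorem holds with [A = 1] and [N0 = 10]. *)

Require Import Defs.
From HB Require Import structures.
From mathcomp Require Import all_boot all_order all_algebra.
From mathcomp Require Import all_classical all_reals all_analysis.
From mathcomp Require Import measurable_realfun ring lra.
Set Implicit Arguments.
Unset Strict Implicit.
Unset Printing Implicit Defensive.

Import Order.TTheory GRing.Theory Num.Theory.
Import numFieldNormedType.Exports.
Local Open Scope classical_set_scope.
Local Open Scope ring_scope.

(** * Bounded measurable functions *)

Definition bmf {d} {T : measurableType d} {R : realType} (f : T -> R) :=
  measurable_fun [set: T] f /\ exists B, forall x, `|f x| <= B.

Section bmf.
Context {d} {T : measurableType d} {R : realType}.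
Implicit Types f g : T -> R.

Lemma bmf_cst c : bmf (fun _ : T => c : R).
Proof. by split; [exact: measurable_cst | exists `|c|]. Qed.

Lemma bmfD f g : bmf f -> bmf g -> bmf (fun x => f x + g x).
Proof.
move=> [mf [B fB]] [mg [C gC]]; split; first exact: measurable_funD.
by exists (B + C) => x; rewrite (le_trans (ler_normD _ _))// lerD.
Qed.

Lemma bmfM f g : bmf f -> bmf g -> bmf (fun x => f x * g x).
Proof.
move=> [mf [B fB]] [mg [C gC]]; split; first exact: measurable_funM.
by exists (B * C) => x; rewrite normrM ler_pM.
Qed.

Lemma bmfN f : bmf f -> bmf (fun x => - f x).
Proof.
move=> /(bmfM (bmf_cst (-1))); congr bmf.
by apply/funext => x; rewrite mulN1r.
Qed.

Lemma bmfB f g : bmf f -> bmf g -> bmf (fun x => f x - g x).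
Proof. by move=> ? /bmfN; exact: bmfD. Qed.

Lemma bmf_expR f : bmf f -> bmf (fun x => expR (f x)).
Proof.
move=> [mf [B fB]]; split; first exact: measurableT_comp.
exists (expR B) => x; rewrite ger0_norm ?expR_ge0// ler_expR.
by rewrite (le_trans (ler_norm _)).
Qed.

Lemma bmf_inv f b : 0 < b -> (forall x, b <= f x) -> bmf f ->
  bmf (fun x => (f x)^-1).
Proof.
move=> b0 bf [mf [B fB]]; split.
  (* On positive reals inversion is the real power of exponent -1, whose measurability is known. *)
  rewrite (_ : (fun x => _) = (fun x => f x `^ (-1))).
    exact: (measurableT_comp (@measurable_powR R (-1)) mf).
  by apply/funext => x; rewrite powR_inv1// (le_trans (ltW b0)).
exists b^-1 => x; have f0 : 0 < f x by rewrite (lt_le_trans b0).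
by rewrite gtr0_norm ?invr_gt0// lef_pV2.
Qed.

Lemma bmf_comp {d'} {T' : measurableType d'} (h : T' -> T) f :
  measurable_fun setT h -> bmf f -> bmf (f \o h).
Proof.
move=> mh [mf [B fB]]; split; first exact: measurableT_comp.
by exists B => x; exact: fB.
Qed.

Lemma bmf_indic (E : set T) : measurable E -> bmf (\1_E : T -> R).
Proof.
move=> mE; split; first exact: measurable_indic.
by exists 1 => x; rewrite indicE; case: (_ \in _); rewrite ?normr1// normr0.
Qed.

End bmf.

(** * Integration over the unit interval *)

Section int01.
Context {R : realType}.
Implicit Types f g : R -> R.
Local Notation mu := (@lebesgue_measure R).

Let mu01 : mu `[0%R, 1%R] = 1%E.
Proof. by rewrite lebesgue_measure_itv /= lte01 oppr0 adde0. Qed.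

Lemma bmf_integrable f : bmf f -> mu.-integrable `[0, 1] (EFin \o f).
Proof.
move=> [mf [B fB]]; apply: measurable_bounded_integrable => //.
- by rewrite [X in (X < _)%E]mu01 ltry.
- exact: measurable_funS mf.
- exists B; split; first exact: num_real.
  by move=> M BM x _; exact: le_trans (fB x) (ltW BM).
Qed.

(** A bounded integrand over [[0, 1]] has a finite integral, so the [fine] in [int01] loses
    nothing. *)
Lemma int01E f : bmf f ->
  (\int[mu]_(x in `[0%R, 1%R]) (f x)%:E)%E = (int01 f)%:E.
Proof.
by move=> /bmf_integrable If; rewrite /int01 fineK//; exact: integrable_fin_num.
Qed.

Lemma int01_cst c : int01 (fun=> c : R) = c.
Proof. 
by rewrite [LHS](Rintegral_cst mu)// [X in fine X]mu01 mulr1. Qed.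

Lemma int01D f g : bmf f -> bmf g ->
  int01 (fun x => f x + g x) = int01 f + int01 g.
Proof.
by move=> /bmf_integrable If /bmf_integrable Ig; exact: (RintegralD (mu := mu)).
Qed.

Lemma int01Zl c f : bmf f -> int01 (fun x => c * f x) = c * int01 f.
Proof. by move=> /bmf_integrable If; exact: (RintegralZl (mu := mu)). Qed.

Lemma int01B f g : bmf f -> bmf g ->
  int01 (fun x => f x - g x) = int01 f - int01 g.
Proof.
by move=> /bmf_integrable If /bmf_integrable Ig; exact: (RintegralB (mu := mu)).
Qed.

Lemma le_int01 f g : bmf f -> bmf g -> (forall x, f x <= g x) ->
  int01 f <= int01 g.
Proof.
move=> /bmf_integrable If /bmf_integrable Ig fg.
exact: (le_Rintegral (mu := mu)).
Qed.

Lemma int01_ge f b : bmf f -> (forall x, b <= f x) -> b <= int01 f.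
Proof. by move=> ? ?; rewrite -[leLHS]int01_cst le_int01//; exact: bmf_cst. Qed.

Lemma int01_le f b : bmf f -> (forall x, f x <= b) -> int01 f <= b.
Proof. by move=> ? ?; rewrite -[leRHS]int01_cst le_int01//; exact: bmf_cst. Qed.

(** Adding the bound [B] and multiplying by the indicator of [[0, 1]] gives a nonnegative function
    on the product, so Tonelli's theorem makes its partial integral measurable; subtracting [B]
    returns to [f]. *)
Lemma bmf_int01 {d} {T : measurableType d} (f : T * R -> R) :
  bmf f -> bmf (fun t => int01 (fun x => f (t, x))).
Proof.
move=> bf; have bft t : bmf (fun x => f (t, x)) by exact: bmf_comp bf.
have [mf [B fB]] := bf.
split; last first.
  exists B => t; rewrite ler_norml; apply/andP; split.
    by apply: int01_ge => // x; have := fB (t, x); rewrite ler_norml => /andP[].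
  by apply: int01_le => // x; have := fB (t, x); rewrite ler_norml => /andP[].
pose F := fun tx : T * R => ((f tx + B) * \1_(`[0, 1]%classic : set R) tx.2)%:E.
have F0 tx : (0 <= F tx)%E.
  rewrite lee_fin mulr_ge0//; have := fB tx; rewrite ler_norml => /andP[+ _].
  by rewrite -subr_ge0 opprK.
have mF : measurable_fun setT F.
  apply/measurable_EFinP/measurable_funM; first exact: measurable_funD.
  have m1 : measurable_fun setT (\1_(`[0, 1]%classic : set R) : R -> R).
    exact: measurable_indic.
  exact: (measurableT_comp m1 measurable_snd).
have := @measurable_fun_fubini_tonelli_F _ _ _ _ _ mu F mF F0.
move=> mG; rewrite (_ : (fun t => _) =
    (fun t => fine (fubini_F mu F t) - B)); last first.
  apply/funext => t; rewrite /fubini_F.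
  rewrite (_ : (\int[mu]_y F (t, y) = (int01 (fun x => f (t, x) + B))%:E)%E).
    by rewrite /= int01D// ?int01_cst ?addrK//; exact: bmf_cst.
  rewrite -int01E; last by apply: bmfD => //; exact: bmf_cst.
  rewrite [RHS]integral_mkcond; apply: eq_integral => y _.
  rewrite /F /= patchE indicE; case: (y \in _); rewrite ?mulr1// mulr0//.
apply: measurable_funB => //.
exact: (measurableT_comp (fine_measurable measurableT) mG).
Qed.

End int01.

(** * Iterated integrals over tuples *)

Section iterR.
Context {R : realType}.

(* Unlike [iterint], this peels off the last coordinate, so that the innermost
   integral is the one which is turned into a conditional expectation. *)
Fixpoint iterR n : (n.-tuple R -> R) -> R :=
  match n with
  | 0 => fun f => f [tuple]
  | m.+1 => fun f => iterR (fun t => int01 (fun x => f (rcons_tuple t x)))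
  end.

(** The last index is exactly the one that does not restrict to ['I_n]; casing on [insub] depends on
    [i] alone, so each coordinate of the tuple is visibly a projection. *)
Lemma tnth_rcons n (t : n.-tuple R) x i :
  tnth (rcons_tuple t x) i =
  if insub (val i) is Some j then tnth t j else x.
Proof.
rewrite (tnth_nth x) /= nth_rcons size_tuple.
case: insubP => [j ij vj|]; first by rewrite ij (tnth_nth x) vj.
by case: ltngtP => // ni; have := ltn_ord i; rewrite ltnS leqNgt ni.
Qed.

Lemma tnth_ins n (i j : 'I_n) x (t : n.-tuple R) :
  tnth (ins i x t) j = if j == i then x else tnth t j.
Proof. by rewrite tnth_mktuple. Qed.

Lemma insC n (i j : 'I_n) x y (t : n.-tuple R) : i != j ->
  ins i x (ins j y t) = ins j y (ins i x t).
Proof.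
move=> ij; apply: eq_from_tnth => k; rewrite !tnth_ins.
by case: (eqVneq k i) => // ->; rewrite (negbTE ij).
Qed.

Lemma ins_tnth n (i : 'I_n) (t : n.-tuple R) : ins i (tnth t i) t = t.
Proof. by apply: eq_from_tnth => j; rewrite tnth_ins; case: eqP => // ->. Qed.

Lemma ins_rcons_max n (t : n.-tuple R) x y :
  ins ord_max y (rcons_tuple t x) = rcons_tuple t y.
Proof.
apply: eq_from_tnth => k; rewrite tnth_ins !tnth_rcons.
case: insubP => [j kn _|kn]; last first.
  suff -> : k == ord_max by [].
  by apply/eqP/val_inj/eqP; rewrite /= eqn_leq -ltnS ltn_ord leqNgt.
by case: eqP kn => // ->; rewrite ltnn.
Qed.

Lemma ins_rcons n (t : n.-tuple R) x y (i : 'I_n) :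
  ins (widen_ord (leqnSn n) i) y (rcons_tuple t x) = rcons_tuple (ins i y t) x.
Proof.
apply: eq_from_tnth => k; rewrite tnth_ins !tnth_rcons.
case: insubP => [j kn jk|kn].
  by rewrite tnth_ins -val_eqE /= -jk.
case: eqP => // ki; have := ltn_ord i; move: kn; rewrite ki /= => kn.
by rewrite (negbTE kn).
Qed.

Lemma measurable_rcons n : measurable_fun setT
  (fun p : n.-tuple R * R => rcons_tuple p.1 p.2 : n.+1.-tuple R).
Proof.
apply/measurable_fun_tnthP => i.
rewrite (_ : _ \o _ = fun p : n.-tuple R * R =>
    if insub (val i) is Some j then tnth p.1 j else p.2); last first.
  by apply/funext => p /=; rewrite tnth_rcons.
case: (insub (val i)) => [j|]; last exact: measurable_snd.
exact: (measurableT_comp (@measurable_tnth _ R n j) measurable_fst).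
Qed.

Lemma bmf_rcons n (f : n.+1.-tuple R -> R) t :
  bmf f -> bmf (fun x => f (rcons_tuple t x)).
Proof.
apply: (bmf_comp (h := fun x => rcons_tuple t x)).
exact: (measurableT_comp (@measurable_rcons n) (pair1_measurable t)).
Qed.

Lemma bmf_int01_rcons n (f : n.+1.-tuple R -> R) :
  bmf f -> bmf (fun t => int01 (fun x => f (rcons_tuple t x))).
Proof.
move=> bf.
exact: (bmf_int01 (bmf_comp (@measurable_rcons n) bf)).
Qed.

Lemma iterRD n (f g : n.-tuple R -> R) : bmf f -> bmf g ->
  iterR (fun t => f t + g t) = iterR f + iterR g.
Proof.
elim: n f g => //= n IH f g bf bg; rewrite -IH; try exact: bmf_int01_rcons.
by congr iterR; apply/funext => t; rewrite int01D//; exact: bmf_rcons.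
Qed.

Lemma iterRZl n c (f : n.-tuple R -> R) : bmf f ->
  iterR (fun t => c * f t) = c * iterR f.
Proof.
elim: n f => //= n IH f bf; rewrite -IH; try exact: bmf_int01_rcons.
by congr iterR; apply/funext => t; rewrite int01Zl//; exact: bmf_rcons.
Qed.

Lemma le_iterR n (f g : n.-tuple R -> R) : bmf f -> bmf g ->
  (forall t, f t <= g t) -> iterR f <= iterR g.
Proof.
elim: n f g => //= n IH f g bf bg fg; apply: IH; try exact: bmf_int01_rcons.
by move=> t; apply: le_int01 => //; exact: bmf_rcons.
Qed.

(** The order of integration is the same on both sides: the last coordinate is already the innermost
    integral of [iterint], and only the grouping changes. *)
Lemma iterint_rcons n (f : n.+1.-tuple R -> \bar R) :
  iterint f =
  iterint (fun t : n.-tuple R =>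
    \int[lebesgue_measure]_(x in `[0%R, 1%R]) f (rcons_tuple t x))%E.
Proof.
elim: n f => [|n IH] f.
  rewrite /=; apply: eq_integral => x _; congr (f _).
  exact/val_inj.
have E m (h : m.+1.-tuple R -> \bar R) : iterint h =
  (\int[lebesgue_measure]_(x in `[0%R, 1%R])
     iterint (fun t => h (cons_tuple x t)))%E by [].
rewrite [LHS]E [RHS]E; apply: eq_integral => x _; rewrite IH.
congr iterint; apply/funext => t; apply: eq_integral => y _; congr (f _).
exact/val_inj.
Qed.

Lemma iterint_iterR n (f : n.-tuple R -> R) : bmf f ->
  iterint (fun t => (f t)%:E) = (iterR f)%:E.
Proof.
elim: n f => [//|n IH] f bf; rewrite iterint_rcons /= -IH; last first.
  exact: bmf_int01_rcons.
by congr iterint; apply/funext => t; rewrite int01E//; exact: bmf_rcons.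
Qed.

End iterR.

(** * Moment generating function of a Bernoulli variable *)

Section hoeffding.
Context {R : realType}.

Lemma le_of_is_derive_ge0 (f df : R -> R) (u : R) :
  (forall x, is_derive x (1 : R) f (df x)) ->
  (forall x, 0 <= x -> 0 <= df x) -> 0 <= u -> f 0 <= f u.
Proof.
move=> fdf df0 u0.
have [|c] := MVT_segment u0 (fun x _ => fdf x).
  apply/continuous_subspaceT => x.
  by apply/differentiable_continuous/derivable1_diffP; exact: ex_derive.
rewrite in_itv /= => /andP[c0 _]; rewrite subr0 => e.
by rewrite -subr_ge0 e mulr_ge0// df0.
Qed.

(** With [D] the moment generating function, [q = (ln D)'] satisfies [q 0 = p] and
    [q' = q (1 - q) <= 1/4]. Integrating from 0 once gives [q x <= p + x/4], and twice gives the
    bound on [ln (D u)]. *)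
Lemma bernoulli_mgf_le (p u : R) : 0 <= p <= 1 -> 0 <= u ->
  1 - p + p * expR u <= expR (p * u + u ^+ 2 / 8).
Proof.
move=> /andP[p0 p1] u0.
pose D x := 1 - p + p * expR x.
have D0 x : 0 < D x.
  have e0 := expR_gt0 x; rewrite /D; have [->|pN0] := eqVneq p 0; first lra.
  have : 0 < p * expR x by rewrite mulr_gt0// lt0r pN0.
  lra.
pose q x := p * expR x / D x.
have dD x : is_derive x (1 : R) D (p * expR x).
  by rewrite /D; apply: is_derive_eq; rewrite add0r mul1r.
have dV x : is_derive x (1 : R) (fun y => (D y)^-1)
    (- (D x) ^- 2 * (p * expR x)).
  by apply: is_deriveV; rewrite gt_eqF.
have dq x : is_derive x (1 : R) q (q x * (1 - q x)).
  rewrite /q; apply: is_derive_eq; rewrite /GRing.scale /=.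
  have := D0 x => /lt0r_neq0; move: (D x) (expR x) => d e d0.
  by field.
have D01 : D 0 = 1 by rewrite /D expR0; lra.
have q01 : q 0 = p by rewrite /q D01 expR0 divr1 mulr1.
have dqh x : is_derive x (1 : R) (fun y => 4^-1 * y - q y)
    (4^-1 - q x * (1 - q x)).
  by apply: is_derive_eq; rewrite /GRing.scale /= mulr1.
have qle x : 0 <= x -> q x <= p + 4^-1 * x.
  move=> x0; have := le_of_is_derive_ge0 dqh _ x0.
  rewrite q01 mulr0 sub0r => H; have {H} : - p <= 4^-1 * x - q x.
    (* [1/4 - q (1 - q)] is the square of [q - 1/2]. *)
    by apply: H => y _; have := sqr_ge0 (q y - 2^-1); lra.
  lra.
have dln x : is_derive x (1 : R) (fun y => ln (D y)) (q x).
  have := is_derive1_ln (D0 x) => h; apply: is_derive_eq.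
  by rewrite /q mulrC.
have dphi x : is_derive x (1 : R) (fun y => p * y + 8^-1 * (y * y) - ln (D y))
    (p + 4^-1 * x - q x).
  by apply: is_derive_eq; rewrite /GRing.scale /= !mulr1; lra.
have := le_of_is_derive_ge0 dphi _ u0.
rewrite D01 ln1 !mulr0 addr0 subr0 => H.
have {H} h : ln (D u) <= p * u + u ^+ 2 / 8.
  have : 0 <= p * u + 8^-1 * (u * u) - ln (D u).
    by apply: H => y y0; have := qle y y0; lra.
  by rewrite expr2; lra.
by rewrite -[leLHS](@lnK _ (D u)) ?posrE// ler_expR.
Qed.
End hoeffding.

Ltac bmf_tac := repeat first
  [ assumption | exact: bmf_cst | apply: bmfB | apply: bmfD | apply: bmfM
  | apply: bmf_expR ].

(** * Estimates for densities in one variable *)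

Section one_site.
Context {R : realType}.
Implicit Types f g h phi : R -> R.

(** Convexity: evaluate the tangent of the exponential at [s * u] in the points [0] and [u], and
    average with weights [1 - s] and [s]; the slope terms cancel. *)
Lemma expR_chord (s u : R) : 0 <= s <= 1 ->
  expR (s * u) <= 1 - s + s * expR u.
Proof.
move=> /andP[s0 s1]; set z := s * u.
have tangent y : expR z * (1 + (y - z)) <= expR y.
  by rewrite -[leRHS](subrK z) subrK -{2}(subrK z y) [y - z + z]addrC expRD
    ler_wpM2l ?expR_ge0// expR_ge1Dx.
have := ler_wpM2l s0 (tangent u).
have s1' : 0 <= 1 - s by lra.
have := ler_wpM2l s1' (tangent 0).
rewrite expR0 mulr1 => h0 h1; rewrite (le_trans _ (lerD h0 h1))// le_eqVlt.
by apply/orP; left; apply/eqP; rewrite /z; ring.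
Qed.

Lemma bounded_osc_itv phi (c : R) : bmf phi ->
  (forall x y, phi x <= phi y + c) ->
  exists al, forall x, al <= phi x <= al + c.
Proof.
move=> [_ [B phiB]] osc; exists (inf (range phi)) => x; apply/andP; split.
  apply: ge_inf; last by exists x.
  by exists (- B) => _ [y _ <-]; have := phiB y; rewrite ler_norml => /andP[].
rewrite -lerBlDr; apply: lb_le_inf; first by exists (phi 0), 0.
by move=> _ [y _ <-]; rewrite lerBlDr.
Qed.

Lemma bounded_ratio_itv phi (K : R) : 0 < K -> bmf phi ->
  (forall x y, phi x <= K * phi y) ->
  exists al, forall x, al <= phi x <= K * al.
Proof.
move=> K0 [_ [B phiB]] osc; exists (inf (range phi)) => x; apply/andP; split.
  apply: ge_inf; last by exists x.
  by exists (- B) => _ [y _ <-]; have := phiB y; rewrite ler_norml => /andP[].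
rewrite -ler_pdivrMl//; apply: lb_le_inf; first by exists (phi 0), 0.
by move=> _ [y _ <-]; rewrite ler_pdivrMl.
Qed.

(** Rescale [phi] to [s] with values in [[0, 1]]. The chord bound makes the exponential affine in
    [s], which reduces the claim to a Bernoulli variable of mean [p]. The density [f] stays
    unnormalised so that its mass can serve as the density of the remaining coordinates. *)
Lemma hoeffding_density f phi (b c lam : R) : 0 < b -> (forall x, b <= f x) ->
  bmf f -> bmf phi -> 0 < c -> 0 <= lam ->
  (forall x y, phi x <= phi y + c) ->
  int01 (fun x => expR (lam * phi x) * f x) <=
  int01 f * expR (lam * (int01 (fun x => phi x * f x) / int01 f)
                  + lam ^+ 2 * (c ^+ 2 / 8)).
Proof.
move=> b0 bf mf mphi c0 lam0 osc.
have [al alP] := bounded_osc_itv mphi osc.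
have F0 : 0 < int01 f by rewrite (lt_le_trans b0)// int01_ge.
have f0 x : 0 < f x by rewrite (lt_le_trans b0).
pose u := lam * c; pose s x := c^-1 * (phi x - al).
have u0 : 0 <= u by rewrite mulr_ge0// ltW.
have s01 x : 0 <= s x <= 1.
  have /andP[h1 h2] := alP x; rewrite /s ler_pdivrMl// mulr1 lerBlDl h2.
  by rewrite mulr_ge0 ?invr_ge0 ?subr_ge0// ltW.
have ms : bmf s.
  by apply: bmfM; [exact: bmf_cst|apply: bmfB => //; exact: bmf_cst].
pose p := int01 (fun x => s x * f x) / int01 f.
have pE : p * int01 f = int01 (fun x => s x * f x) by rewrite /p divfK// gt_eqF.
have p01 : 0 <= p <= 1.
  apply/andP; split.
    rewrite divr_ge0 ?(ltW F0)//; apply: int01_ge; first exact: bmfM.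
    by move=> x; have /andP[h _] := s01 x; rewrite mulr_ge0// ltW.
  rewrite /p ler_pdivrMr// mul1r; apply: le_int01 => //; first exact: bmfM.
  by move=> x; have /andP[_ h] := s01 x; rewrite ler_piMl// ltW.
have mE : lam * (int01 (fun x => phi x * f x) / int01 f) = lam * al + p * u.
  have -> : int01 (fun x => phi x * f x) =
      int01 (fun x => c * (s x * f x) + al * f x).
    by congr int01; apply/funext => x; rewrite /s; field; rewrite gt_eqF.
  have msf : bmf (fun x => s x * f x) by exact: bmfM.
  rewrite int01D ?int01Zl//; try by apply: bmfM => //; exact: bmf_cst.
  by rewrite -pE /u; field; rewrite gt_eqF.
have mexp : bmf (fun x => expR (lam * phi x)).
  by apply/bmf_expR/bmfM => //; exact: bmf_cst.
apply: (@le_trans _ _ (int01 (fun x => expR (lam * al) *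
    (f x + (expR u - 1) * (s x * f x))))).
  apply: le_int01; first exact: bmfM.
    apply: bmfM; first exact: bmf_cst.
    apply: bmfD => //; apply: bmfM; first exact: bmf_cst.
    exact: bmfM.
  move=> x; have -> : lam * phi x = lam * al + s x * u.
    by rewrite /s /u; field; rewrite gt_eqF.
  rewrite expRD -mulrA ler_wpM2l ?expR_ge0//.
  have := ler_wpM2r (ltW (f0 x)) (expR_chord u (s01 x)); lra.
rewrite int01Zl; last first.
  apply: bmfD => //; apply: bmfM; first exact: bmf_cst.
  exact: bmfM.
rewrite int01D//; last by apply: bmfM; [exact: bmf_cst|exact: bmfM].
rewrite int01Zl; last exact: bmfM.
rewrite -pE mE -addrA expRD [leRHS]mulrCA ler_wpM2l ?expR_ge0//.
have := ler_wpM2l (ltW F0) (bernoulli_mgf_le p01 u0).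
have -> : lam ^+ 2 * (c ^+ 2 / 8) = u ^+ 2 / 8 by rewrite /u; field.
lra.
Qed.

(** The functions [g * int01 f] and [f * int01 g] have the same integral, so [phi] may be centred at
    the midpoint [m] of its range, where [|phi - m| <= c/2]. Integrating the ratio hypothesis in one
    variable bounds their difference by [(K - 1) * f * int01 g]. *)
Lemma density_ratio_compare f g phi (b c K : R) : 0 < b ->
  (forall x, b <= f x) -> (forall x, b <= g x) ->
  bmf f -> bmf g -> bmf phi -> 1 <= K ->
  (forall x y, g x * f y <= K * (f x * g y)) ->
  (forall x y, phi x <= phi y + c) ->
  int01 (fun x => phi x * g x) / int01 g <=
  int01 (fun x => phi x * f x) / int01 f + c * (K - 1) / 2.
Proof.
move=> b0 bf bg mf mg mphi K1 gf osc.
have [al alP] := bounded_osc_itv mphi osc.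
have F0 : 0 < int01 f by rewrite (lt_le_trans b0)// int01_ge.
have G0 : 0 < int01 g by rewrite (lt_le_trans b0)// int01_ge.
have f0 x : 0 < f x by rewrite (lt_le_trans b0).
have g0 x : 0 < g x by rewrite (lt_le_trans b0).
have gF x : g x * int01 f <= K * (f x * int01 g).
  rewrite -!int01Zl//; last by apply: bmfM => //; exact: bmf_cst.
  apply: le_int01 => //; do ?[apply: bmfM => //]; do ?exact: bmf_cst.
have fG x : f x * int01 g <= K * (g x * int01 f).
  rewrite -!int01Zl//; last by apply: bmfM => //; exact: bmf_cst.
  apply: le_int01 => //; do ?[apply: bmfM => //]; do ?exact: bmf_cst.
  by move=> y; have := gf y x; rewrite mulrC; rewrite [g x * _]mulrC.
have c0 : 0 <= c by have := osc 0 0; lra.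
pose m := al + c / 2.
have pt x : (phi x - m) * (g x * int01 f - f x * int01 g) <=
    c / 2 * (K - 1) * (f x * int01 g).
  have fG0 : 0 <= f x * int01 g by rewrite mulr_ge0// ltW.
  have h1 := gF x; have h2 := fG x.
  move: (f x * int01 g) (g x * int01 f) h1 h2 fG0 => X Y h1 h2 X0.
  have hY : `|Y - X| <= (K - 1) * X.
    rewrite ler_norml; apply/andP; split; last by lra.
    (* Here [Y >= X / K], and [1 / K >= 2 - K] because [(K - 1)^2 >= 0]. *)
    rewrite -subr_ge0.
    have : 0 <= (K - 1) * (K * Y - X) + (K - 1) ^+ 2 * X.
      by rewrite addr_ge0// mulr_ge0 ?sqr_ge0//; lra.
    nra.
  have hm : `|phi x - m| <= c / 2.
    by have /andP[? ?] := alP x; rewrite ler_norml /m; lra.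
  rewrite (le_trans (ler_norm _))// normrM -mulrA ler_pM//.
have mgf : bmf (fun x => g x * int01 f - f x * int01 g).
  by apply: bmfB; apply: bmfM => //; exact: bmf_cst.
have := @le_int01 _ _ _ _ _ pt.
have -> : int01 (fun x => (phi x - m) * (g x * int01 f - f x * int01 g)) =
  int01 f * int01 (fun x => phi x * g x) -
  int01 g * int01 (fun x => phi x * f x).
  rewrite (_ : (fun x => _) = (fun x =>
    (int01 f * (phi x * g x) - int01 g * (phi x * f x)) +
    (m * int01 g * f x - m * int01 f * g x))); last first.
    by apply/funext => x; ring.
  rewrite int01D ?int01B ?int01Zl//; first ring.
  all: bmf_tac.
rewrite (_ : (fun x => c / 2 * (K - 1) * (f x * int01 g)) =
   (fun x => c / 2 * (K - 1) * int01 g * f x)); last first.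
  by apply/funext => x; ring.
rewrite int01Zl// => H.
have {H} : int01 f * int01 (fun x => phi x * g x) -
   int01 g * int01 (fun x => phi x * f x) <=
   c / 2 * (K - 1) * int01 g * int01 f.
  apply: H; first by apply: bmfM => //; apply: bmfB => //; exact: bmf_cst.
  by apply: bmfM => //; exact: bmf_cst.
move=> H; rewrite -(ler_pM2r (mulr_gt0 F0 G0)).
have -> : int01 (fun x => phi x * g x) / int01 g * (int01 f * int01 g) =
  int01 f * int01 (fun x => phi x * g x) by field; rewrite gt_eqF.
have -> : (int01 (fun x => phi x * f x) / int01 f + c * (K - 1) / 2) *
    (int01 f * int01 g) = int01 g * int01 (fun x => phi x * f x)
   + c / 2 * (K - 1) * int01 g * int01 f by field; rewrite gt_eqF.
lra.
Qed.

End one_site.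

(** * Cross-ratios, marginals and the induction on the dimension *)

Section marginal.
Context {R : realType}.

(** For positive [rho] this bounds the mixed second differences of [ln rho] by [ln K], in a form
    without division. The entries of [t] at [i] and [j] are overwritten. *)
Definition cross_ratio n (K : R) (rho : n.-tuple R -> R) :=
  forall (i j : 'I_n), i != j -> forall t p p' q q',
  rho (ins i p (ins j q t)) * rho (ins i p' (ins j q' t)) <=
  K * (rho (ins i p' (ins j q t)) * rho (ins i p (ins j q' t))).

Definition marginal n (rho : n.+1.-tuple R -> R) (t : n.-tuple R) :=
  int01 (fun x => rho (rcons_tuple t x)).

Lemma cross_ratio_le n (K K' : R) (rho : n.-tuple R -> R) :
  (forall t, 0 <= rho t) -> K <= K' -> cross_ratio K rho -> cross_ratio K' rho.
Proof.
move=> rho0 KK' cr i j ij t p p' q q'.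
rewrite (le_trans (cr _ _ ij _ _ _ _ _))//.
by rewrite ler_wpM2r// mulr_ge0.
Qed.

(** The four functions are the corners of a rectangle, seen as functions of the integrated
    coordinate. The quotient [v / u] lies between [al] and [K * al], so its means under the
    densities [u] and [u'] differ by at most [(K - 1)^2 * al / 2], while [v' <= K * (v / u) * u']
    pointwise. The loss is of second order because both the oscillation of [v / u] and the
    discrepancy of the densities are of order [K - 1]. *)
Lemma cross_ratio_int01 (u v u' v' : R -> R) (b K : R) : 0 < b ->
  (forall x, b <= u x) -> (forall x, b <= v x) -> (forall x, b <= u' x) ->
  bmf u -> bmf v -> bmf u' -> bmf v' -> 1 <= K ->
  (forall x, u x * v' x <= K * (v x * u' x)) ->
  (forall x y, u' x * u y <= K * (u x * u' y)) ->
  (forall x y, v x * u y <= K * (u x * v y)) ->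
  int01 u * int01 v' <=
  K * (1 + (K - 1) ^+ 2 / 2) * (int01 v * int01 u').
Proof.
move=> b0 bu bv bu' mu mv mu' mv' K1 uv uu vu.
have u0 x : 0 < u x by rewrite (lt_le_trans b0).
have v0 x : 0 < v x by rewrite (lt_le_trans b0).
have u'0 x : 0 < u' x by rewrite (lt_le_trans b0).
have U0 : 0 < int01 u by rewrite (lt_le_trans b0)// int01_ge.
have U'0 : 0 < int01 u' by rewrite (lt_le_trans b0)// int01_ge.
have K0 : 0 < K by lra.
have mD : bmf (fun x => v x / u x).
  by apply: bmfM => //; exact: bmf_inv b0 bu mu.
have [al alP] : exists al, forall x, al <= v x / u x <= K * al.
  apply: bounded_ratio_itv => // x y.
  rewrite ler_pdivrMr// (_ : K * _ * _ = K * (u x * v y) / u y); last by ring.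
  by rewrite ler_pdivlMr.
have := @density_ratio_compare _ u u' (fun x => v x / u x) b ((K - 1) * al) K b0
  bu bu' mu mu' mD K1 uu.
have -> : int01 (fun x => v x / u x * u x) = int01 v.
  by congr int01; apply/funext => x; rewrite divfK// gt_eqF.
move=> H; have {H} : int01 (fun x => v x / u x * u' x) / int01 u' <=
    int01 v / int01 u + (K - 1) * al * (K - 1) / 2.
  by apply: H => x y; have /andP[_ ?] := alP x; have /andP[? _] := alP y; lra.
have alV : al <= int01 v / int01 u.
  rewrite ler_pdivlMr// -int01Zl//; apply: le_int01 => //; first by bmf_tac.
  by move=> x; rewrite -ler_pdivlMr//; have /andP[] := alP x.
have K2 := sqr_ge0 (K - 1).
rewrite ler_pdivrMr// => H.
have V'le : int01 v' <= K * int01 (fun x => v x / u x * u' x).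
  rewrite -int01Zl; last by bmf_tac.
  apply: le_int01 => //; first by bmf_tac.
  move=> x; rewrite mulrAC mulrA ler_pdivlMr//.
  by rewrite mulrC (le_trans (uv x)).
have {}H : int01 v' <=
    K * ((1 + (K - 1) ^+ 2 / 2) * (int01 v / int01 u) * int01 u').
  rewrite (le_trans V'le)// ler_wpM2l ?(ltW K0)// (le_trans H)//.
  rewrite ler_wpM2r ?(ltW U'0)//.
  have := ler_wpM2l K2 alV; lra.
have := ler_wpM2l (ltW U0) H.
rewrite [X in _ <= X](_ : _ =
  K * (1 + (K - 1) ^+ 2 / 2) * (int01 v * int01 u'))//.
by field; rewrite gt_eqF.
Qed.

(** The [0] is a filler that [ins] overwrites; in this form hypotheses about [ins] apply to the last
    coordinate. *)
Lemma rcons_ins0 n (t : n.-tuple R) x :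
  rcons_tuple t x = ins ord_max x (rcons_tuple t 0).
Proof. by rewrite ins_rcons_max. Qed.

Lemma widen_neq_max n (i : 'I_n) : widen_ord (leqnSn n) i != ord_max.
Proof. by rewrite -val_eqE /= ltn_eqF. Qed.

(** The three inequalities asked of the corners are cross-ratio bounds for [i] with [j], for [j]
    with the last coordinate, and for [i] with the last coordinate. *)
Lemma marginal_cross_ratio n (K b : R) (rho : n.+1.-tuple R -> R) :
  0 < b -> (forall t, b <= rho t) -> bmf rho -> 1 <= K ->
  cross_ratio K rho ->
  cross_ratio (K * (1 + (K - 1) ^+ 2 / 2)) (marginal rho).
Proof.
move=> b0 brho mrho K1 cr i j ij t p p' q q'.
have mr t' : bmf (fun x => rho (rcons_tuple t' x)) by exact: bmf_rcons.
pose W k := widen_ord (leqnSn n) k.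
have ijW : W i != W j by rewrite -val_eqE /= val_eqE.
apply: (cross_ratio_int01 b0) => //.
- by move=> x; rewrite -!ins_rcons; exact: cr.
- move=> x y.
  have := cr _ _ (widen_neq_max j) (rcons_tuple (ins i p t) 0) q' q x y.
  by rewrite !ins_rcons_max !ins_rcons !(insC _ _ _ ij).
- move=> x y.
  have := cr _ _ (widen_neq_max i) (rcons_tuple (ins j q t) 0) p' p x y.
  by rewrite !ins_rcons_max !ins_rcons.
Qed.

(* If [n] coordinates are left, [K = 1 + 1/w].  Integrating one of them out
   replaces [w] by [w - 11/20] (any constant larger than [1/2] works once [w] is
   large enough) and [c] by [c w / (w - 11/20)], so [c w] is invariant. *)
Lemma mgf_bound n (rho g : n.-tuple R -> R) (b c C lam w : R) :
  0 < b -> (forall t, b <= rho t) -> bmf rho -> bmf g -> 0 < c -> 0 <= lam ->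
  11 / 20 * n%:R + 5 <= w ->
  c * w <= C * (w - 11 / 20 * n%:R) ->
  cross_ratio (1 + w^-1) rho ->
  (forall j t x y, g (ins j x t) <= g (ins j y t) + c) ->
  iterR (fun t => expR (lam * g t) * rho t) <=
  iterR rho * expR (lam * (iterR (fun t => g t * rho t) / iterR rho)
                    + lam ^+ 2 * (n%:R * (C ^+ 2 / 8))).
Proof.
elim: n rho g b c w => [|n IH] rho g b c w b0 brho mrho mg c0 lam0 nw cC cr osc.
  have r0 : 0 < rho [tuple] by rewrite (lt_le_trans b0).
  by rewrite /= mul0r mulr0 addr0 mulfK ?gt_eqF// mulrC.
have n0 : 0 <= n%:R :> R by [].
have w5 : 5 <= w by move: nw; rewrite -natr1; lra.
have K1 : 1 <= 1 + w^-1 by rewrite lerDl invr_ge0; lra.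
have rho0 t : 0 < rho t by rewrite (lt_le_trans b0).
have mr t : bmf (fun x => rho (rcons_tuple t x)) by exact: bmf_rcons.
have mgt t : bmf (fun x => g (rcons_tuple t x)) by exact: bmf_rcons.
pose rho' := marginal rho.
have brho' t : b <= rho' t by apply: int01_ge.
have rho'0 t : 0 < rho' t by rewrite (lt_le_trans b0).
have mrho' : bmf rho' by exact: bmf_int01_rcons.
have mgr : bmf (fun t => g t * rho t) by bmf_tac.
pose g' t := marginal (fun t => g t * rho t) t / rho' t.
have mg' : bmf g'.
  by apply: bmfM; [exact: bmf_int01_rcons|exact: bmf_inv b0 brho' mrho'].
pose w' := w - 11 / 20.
pose c' := c * w / w'.
have w'0 : 0 < w' by rewrite /w'; lra.
(* Two moves: changing coordinate [j] in the density, with [g] kept, costs [c / w / 2]; changing it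
   in [g], under a fixed density, costs at most [c]. *)
have osc' j t x y : g' (ins j x t) <= g' (ins j y t) + c'.
  have := @density_ratio_compare _ (fun s => rho (rcons_tuple (ins j y t) s))
    (fun s => rho (rcons_tuple (ins j x t) s))
    (fun s => g (rcons_tuple (ins j x t) s)) b c (1 + w^-1) b0
    (fun=> brho _) (fun=> brho _) (mr _) (mr _) (mgt _) K1.
  move=> H; have {H} : g' (ins j x t) <=
      int01 (fun s =>
        g (rcons_tuple (ins j x t) s) * rho (rcons_tuple (ins j y t) s))
      / rho' (ins j y t) + c * (1 + w^-1 - 1) / 2.
    apply: H => s s'.
      have := cr _ _ (widen_neq_max j) (rcons_tuple t 0) x y s s'.
      by rewrite !ins_rcons_max !ins_rcons.
    by rewrite (rcons_ins0 _ s) (rcons_ins0 _ s').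
  move=> H; rewrite (le_trans H)//.
  have le1 : int01 (fun s =>
      g (rcons_tuple (ins j x t) s) * rho (rcons_tuple (ins j y t) s)) <=
      marginal (fun t => g t * rho t) (ins j y t) + c * rho' (ins j y t).
    have mgr' : bmf (fun s => g (rcons_tuple (ins j y t) s) *
      rho (rcons_tuple (ins j y t) s)) by bmf_tac.
    rewrite /marginal -int01Zl// -int01D//; last by bmf_tac.
    apply: le_int01; [by bmf_tac|by bmf_tac|move=> s].
    by rewrite -mulrDl ler_wpM2r ?(ltW (rho0 _))// -!ins_rcons.
  have le2 : int01 (fun s =>
      g (rcons_tuple (ins j x t) s) * rho (rcons_tuple (ins j y t) s))
      / rho' (ins j y t) <= g' (ins j y t) + c.
    rewrite ler_pdivrMr// mulrDl /g' divfK ?gt_eqF//.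
  (* Multiplied by [w' / c], this reads [w' + w' / w / 2 <= w' + 11/20]. *)
  have le3 : c + c * (1 + w^-1 - 1) / 2 <= c'.
    rewrite /c' ler_pdivlMr//.
    have -> : (c + c * (1 + w^-1 - 1) / 2) * w' = c * (w' + w' / w / 2).
      by field; rewrite gt_eqF//; lra.
    rewrite ler_wpM2l ?(ltW c0)//.
    have : w' / w <= 1 by rewrite ler_pdivrMr ?mul1r /w'; lra.
    by rewrite {2}/w'; lra.
  lra.
have cr' : cross_ratio (1 + w'^-1) rho'.
  apply: cross_ratio_le (marginal_cross_ratio b0 brho mrho K1 cr) => //.
    by move=> t; exact: ltW.
  rewrite [1 + w^-1 - 1]addrAC subrr add0r.
  rewrite (_ : _ * _ = 1 + ((w ^+ 2) + w / 2 + 1 / 2) / w ^+ 3); last first.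
    by field; rewrite gt_eqF//; lra.
  rewrite lerD2l ler_pdivrMr ?exprn_gt0//; last lra.
  rewrite ler_pdivlMl// /w'.
  (* After expansion the claim is [9 w / 40 <= w^2 / 20 + 11 / 40]. *)
  have := mulr_ge0 (_ : 0 <= w) (_ : 0 <= w - 5); nra.
have c'0 : 0 < c' by rewrite /c' divr_gt0// mulr_gt0//; lra.
have c'C : c' * w' <= C * (w' - 11 / 20 * n%:R).
  by rewrite /c' divfK ?gt_eqF// (le_trans cC)// /w' -natr1; lra.
have := IH rho' g' b c' w' b0 brho' mrho' mg' c'0 lam0 _ c'C cr' osc'.
have -> : iterR rho' = iterR rho by [].
have -> : iterR (fun t => g' t * rho' t) = iterR (fun t => g t * rho t).
  by congr iterR; apply/funext => t; rewrite /g' divfK// gt_eqF.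
move=> H; have {}H := H ltac:(by rewrite /w'; move: nw; rewrite -natr1; lra).
(* [C] dominates the oscillation at every stage, so each integration may be charged the same
   [C^2 / 8]. *)
have cleC : c <= C.
  have wn : 0 < w - 11 / 20 * n.+1%:R by lra.
  have nC : 0 <= 11 / 20 * n.+1%:R :> R by rewrite mulr_ge0//; lra.
  rewrite -(ler_pM2r wn) (le_trans _ cC)// ler_wpM2l ?(ltW c0)//; lra.
apply: (@le_trans _ _ (iterR (fun t => expR (lam ^+ 2 * (C ^+ 2 / 8)) *
    (expR (lam * g' t) * rho' t)))).
  apply: (@le_iterR _ n).
  - apply: (@bmf_int01_rcons _ _ (fun t => expR (lam * g t) * rho t)).
    by bmf_tac.
  - by bmf_tac.
  move=> t.
  have gosc x y : g (rcons_tuple t x) <= g (rcons_tuple t y) + c.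
    by rewrite (rcons_ins0 t x) (rcons_ins0 t y).
  have := hoeffding_density b0 (fun x => brho (rcons_tuple t x)) (mr t) (mgt t)
    c0 lam0 gosc.
  move=> h; rewrite (le_trans h)//.
  rewrite [leLHS]mulrC [leRHS]mulrA -expRD ler_wpM2r ?(ltW (rho'0 t))// ler_expR.
  rewrite addrC lerD// ler_wpM2l ?sqr_ge0// ler_wpM2r ?invr_ge0//.
  by rewrite ler_sqr ?nnegrE ?(ltW c0)// (le_trans (ltW c0)).
rewrite iterRZl; last by bmf_tac.
rewrite (le_trans (ler_wpM2l (expR_ge0 _) H))//.
rewrite mulrCA -expRD le_eqVlt; apply/orP; left; apply/eqP.
by congr (_ * expR _); rewrite -natr1; ring.
Qed.
End marginal.

(** * The cone [Vset] and its projective metric *)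

Section Vset_theory.
Context {R : realType}.
Implicit Types f g psi : R -> R.

Lemma periodic1_int f (k : int) x : periodic1 f -> f (x + k%:~R) = f x.
Proof.
move=> pf; have pn (n : nat) y : f (y + n%:R) = f y.
  by elim: n y => [|n IH] y; rewrite ?addr0// -natr1 addrA pf.
case: k => n; first exact: pn.
by rewrite NegzE mulrNz -(pn n.+1 (x - _)) subrK.
Qed.

Lemma periodic1_frac f x : periodic1 f ->
  exists2 y, y \in `[0, 1]%R & f x = f y.
Proof.
move=> pf; exists (x - (Num.floor x)%:~R); last first.
  by rewrite -[in LHS](subrK (Num.floor x)%:~R x) periodic1_int.
have := floor_itv x; rewrite in_itv /= => /andP[h1 h2].
by rewrite subr_ge0 h1 /= lerBlDl ltW// -intrD1.
Qed.

Lemma derive1_periodic f : (forall x, derivable f x 1) ->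
  periodic1 f -> periodic1 (derive1 f).
Proof.
move=> df pf x.
have h : is_derive x (1 : R) (f \o (fun y => y + 1)) (derive1 f (x + 1) * 1).
  apply: is_derive1_comp.
    by rewrite derive1E; apply: DeriveDef.
  by apply: is_derive_eq; rewrite addr0.
rewrite (_ : f \o _ = f) in h; last by apply/funext => y /=; rewrite pf.
by rewrite [RHS]derive1E (@derive_val _ _ _ _ _ _ _ h) mulr1.
Qed.

Lemma derivable_continuous f : (forall x, derivable f x 1) -> continuous f.
Proof.
by move=> df x; apply/differentiable_continuous/derivable1_diffP.
Qed.

Lemma derive1_is_derive f x : derivable f x 1 ->
  is_derive x (1 : R) f (derive1 f x).
Proof. by move=> df; rewrite derive1E; apply: DeriveDef. Qed.

Lemma is_derive1_derive1 f x d : is_derive x (1 : R) f d -> derive1 f x = d.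
Proof. by move=> h; rewrite derive1E (@derive_val _ _ _ _ _ _ _ h). Qed.

Lemma is_derive_ln_comp psi x d : 0 < psi x -> is_derive x (1 : R) psi d ->
  is_derive x (1 : R) (fun y => ln (psi y)) (d / psi x).
Proof.
move=> p0 dp; have := is_derive1_ln p0 => h; apply: is_derive_eq.
by rewrite mulrC.
Qed.

Lemma Vset_log_derive a psi x : Vset a psi -> `|derive1 psi x| < a * psi x.
Proof.
case=> [_ [_ dpsi _ _ _] p0 /(_ x)].
have := is_derive_ln_comp (p0 x) (derive1_is_derive (dpsi x)).
move=> /is_derive1_derive1 ->.
by rewrite normrM normfV (gtr0_norm (p0 x)) ltr_pdivrMr.
Qed.

(** By periodicity both points may be taken in [[0, 1]], hence at distance at most 1, and the mean
    value theorem applies to [ln psi]. *)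
Lemma Vset_log_lip a psi x y : Vset a psi -> ln (psi x) <= ln (psi y) + a.
Proof.
move=> Vpsi; have [pp [_ dpsi _ _ _] p0 la] := Vpsi.
have [x' + ->] := periodic1_frac x pp.
have [y' + ->] := periodic1_frac y pp.
move: x' y' => {}x {}y; rewrite !in_itv /= => /andP[y0 y1] /andP[x0 x1].
have dl z := is_derive_ln_comp (p0 z) (derive1_is_derive (dpsi z)).
have cl : continuous (fun z => ln (psi z)).
  by apply: derivable_continuous => z; have := dl z => h; exact: ex_derive.
have a0 : 0 < a by rewrite (le_lt_trans _ (la 0)).
have lda z : `|derive1 psi z / psi z| < a.
  by have := la z; rewrite (is_derive1_derive1 (dl z)).
have [xy|/ltW yx] := leP x y.
  have [|c _ e] := MVT_segment xy (fun z _ => dl z).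
    exact: continuous_subspaceT.
  have := lda c; rewrite ltr_norml => /andP[l1 l2].
  have : - a <= - (derive1 psi c / psi c) * -1 * (y - x).
    have : 0 <= y - x by lra.
    move: (derive1 psi c / psi c) l1 l2 => d l1 l2 xy0; nra.
  lra.
have [|c _ e] := MVT_segment yx (fun z _ => dl z).
  exact: continuous_subspaceT.
have := lda c; rewrite ltr_norml => /andP[l1 l2].
have : (derive1 psi c / psi c) * (x - y) <= a.
  have : 0 <= x - y by lra.
  move: (derive1 psi c / psi c) l1 l2 => d l1 l2 xy0; nra.
lra.
Qed.

Lemma is_derive_comb f g (t : R) : (forall x, derivable f x 1) ->
  (forall x, derivable g x 1) ->
  forall x, is_derive x (1 : R) (fun y => t * f y - g y)
    (t * derive1 f x - derive1 g x).
Proof.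
move=> df dg x.
have := derive1_is_derive (df x); have := derive1_is_derive (dg x).
by move=> h1 h2; apply: is_derive_eq.
Qed.

Lemma C2_1_comb f g (t : R) : C2_1 f -> C2_1 g ->
  C2_1 (fun y => t * f y - g y).
Proof.
move=> [cf df cf' df' cf''] [cg dg cg' dg' cg''].
have d1 := is_derive_comb t df dg.
have e1 : derive1 (fun y => t * f y - g y) =
    (fun x => t * derive1 f x - derive1 g x).
  by apply/funext => x; exact: is_derive1_derive1.
have d2 := is_derive_comb t df' dg'.
have e2 : derive1 (derive1 (fun y => t * f y - g y)) =
    (fun x => t * derive1 (derive1 f) x - derive1 (derive1 g) x).
  by rewrite e1; apply/funext => x; exact: is_derive1_derive1.
split.
- by apply: derivable_continuous => x; have := d1 x => h; exact: ex_derive.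
- by move=> x; have := d1 x => h; exact: ex_derive.
- rewrite e1; apply: derivable_continuous => x.
  by have := d2 x => h; exact: ex_derive.
- by rewrite e1 => x; have := d2 x => h; exact: ex_derive.
- rewrite e2 => x; apply: cvgB; last exact: cg''.
  by apply: cvgMr; exact: cf''.
Qed.

Lemma periodic_max f : continuous f -> periodic1 f ->
  exists c, forall x, f x <= f c.
Proof.
move=> cf pf.
have [c _ cM] := EVT_max (@ler01 R) (continuous_subspaceT cf).
by exists c => x; have [y y01 ->] := periodic1_frac x pf; exact: cM.
Qed.

(* Compactness of the circle gives [|f'| <= a' f] with [a' < a]; this strict
   margin makes [t f - g] admissible for large [t] even when [a = b]. *)
Lemma Vset_comb a b f g : a <= b -> Vset a f -> Vset a g ->
  exists2 t, 0 < t & Vset b (fun x => t * f x - g x).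
Proof.
move=> ab Vf Vg.
have [pf C2f f0 _] := Vf; have [pg C2g g0 _] := Vg.
have [cf df cf' df' _] := C2f; have [cg dg _ _ _] := C2g.
have a0 : 0 < a.
  have := Vset_log_derive 0 Vf => h; have := le_lt_trans (normr_ge0 _) h.
  by rewrite pmulr_lgt0.
have [c1 h1] : exists c, forall x, `|derive1 f x| / f x <= `|derive1 f c| / f c.
  apply: (@periodic_max (fun x => `|derive1 f x| / f x)).
    move=> x; apply: cvgM; first by apply: cvg_norm; exact: cf'.
    by apply: cvgV; [rewrite gt_eqF|exact: cf].
  by move=> x; rewrite (derive1_periodic df pf) pf.
have [c2 h2] : exists c, forall x, g x / f x <= g c / f c.
  apply: (@periodic_max (fun x => g x / f x)).
    move=> x; apply: cvgM; first exact: cg.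
    by apply: cvgV; [rewrite gt_eqF|exact: cf].
  by move=> x; rewrite pf pg.
set a' := `|derive1 f c1| / f c1 in h1; set M := g c2 / f c2 in h2.
have a'a : a' < a by rewrite /a' ltr_pdivrMr// Vset_log_derive.
have M0 : 0 < M by rewrite divr_gt0.
have b0 : 0 < b by lra.
(* Two demands on [t]: [t > M] makes [t f - g] positive, and [t (b - a') > (b + a) M] gives
   [t |f'| + |g'| < b (t f - g)], using [|f'| <= a' f], [|g'| < a g] and [g <= M f]. *)
pose t := (b + a) * M / (b - a') + M + 1.
have ba' : 0 < b - a' by lra.
have t1 : (b + a) * M < t * (b - a').
  have -> : t * (b - a') = (b + a) * M + (M + 1) * (b - a').
    by rewrite /t; field; rewrite gt_eqF.
  by rewrite ltrDl mulr_gt0//; lra.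
have tM : M < t.
  have : 0 <= (b + a) * M / (b - a').
    by rewrite divr_ge0 ?(ltW ba')// mulr_ge0 ?(ltW M0)//; lra.
  by rewrite /t; lra.
have t0 : 0 < t by lra.
exists t; first exact: t0.
have pos x : 0 < t * f x - g x.
  rewrite subr_gt0 -ltr_pdivrMr//; exact: le_lt_trans (h2 x) tM.
split; [by move=> x; rewrite pf pg | exact: C2_1_comb | exact: pos | move=> x].
have := @is_derive_ln_comp (fun y => t * f y - g y) x _ (pos x)
  (is_derive_comb t df dg x).
move=> /is_derive1_derive1 ->.
rewrite normrM normfV (gtr0_norm (pos x)) ltr_pdivrMr//.
rewrite (le_lt_trans (ler_normB _ _))// normrM (gtr0_norm t0).
have := Vset_log_derive x Vg.
have := h1 x; rewrite ler_pdivrMr// => d1 d2.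
have := h2 x; rewrite ler_pdivrMr// => d3.
have : t * `|derive1 f x| <= t * (a' * f x) by rewrite ler_wpM2l// ltW.
have : (b + a) * g x <= (b + a) * (M * f x) by rewrite ler_wpM2l//; lra.
have : ((b + a) * M) * f x < t * (b - a') * f x by rewrite ltr_pM2r.
lra.
Qed.

(** Every admissible [s] makes [s f - g] positive, so each value of [g / f] is a lower bound of the
    set defining [beta_a]. [Vset_comb] shows that this set is nonempty, so that its [inf] is not a
    default value. *)
Lemma beta_a_bound a b f g : a <= b -> Vset a f -> Vset a g ->
  0 < beta_a b f g /\ forall x, g x <= beta_a b f g * f x.
Proof.
move=> ab Vf Vg; have [_ _ f0 _] := Vf; have [_ _ g0 _] := Vg.
have [t t0 Vt] := Vset_comb ab Vf Vg.
have lb x : g x / f x <= beta_a b f g.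
  apply: lb_le_inf; first by exists t.
  move=> s [s0 [_ _ /(_ x) + _]].
  by rewrite subr_gt0 ler_pdivrMr// => /ltW.
split; first by rewrite (lt_le_trans _ (lb 0))// divr_gt0.
by move=> x; rewrite -ler_pdivrMr.
Qed.

(** Multiply [g x <= beta_a b f g * f x] by [f y <= beta_a b g f * g y]; the product of the two
    constants is the exponential of [theta_a]. *)
Lemma theta_a_ratio a b f g th : a <= b -> Vset a f -> Vset a g ->
  theta_a b f g <= th ->
  forall x y, g x * f y <= expR th * (f x * g y).
Proof.
move=> ab Vf Vg th1 x y; have [_ _ f0 _] := Vf; have [_ _ g0 _] := Vg.
have [b1 h1] := beta_a_bound ab Vf Vg.
have [b2 h2] := beta_a_bound ab Vg Vf.
have := ler_pM (ltW (g0 x)) (ltW (f0 y)) (h1 x) (h2 y).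
move=> h; rewrite (le_trans h)//.
have bb : beta_a b f g * beta_a b g f \is Num.pos by rewrite posrE mulr_gt0.
rewrite mulrACA ler_wpM2r//.
  by rewrite mulr_ge0 ?(ltW (f0 _)) ?(ltW (g0 _)).
by rewrite -[leLHS](lnK bb) ler_expR lnM ?posrE.
Qed.

Lemma tdist_le_half (x y : R) : tdist x y <= 1 / 2.
Proof. rewrite /tdist ge_min; case: leP => //=; lra. Qed.

End Vset_theory.

(** * Cross-ratio and two-sided bounds for densities in [Mclass] *)

Section Mclass_theory.
Context {R : realType}.

(** Numerator and quotient are positive, so the inverse of the integral is; since the inverse of 0
    is 0, a zero integral is excluded too. *)
Lemma cond_dens_gt0 n (rho : n.-tuple R -> R) i t a :
  (forall t, 0 < rho t) -> Vset a (cond_dens rho i t) ->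
  0 < int01 (fun s => rho (ins i s t)).
Proof.
move=> rho0 [_ _ /(_ 0) + _].
by rewrite /cond_dens pmulr_rgt0// invr_gt0.
Qed.

(** The normalising constants of the two conditional densities appear once on each side of the ratio
    inequality and cancel. *)
Lemma Mclass_cross_ratio n (a b L : R) (rho : n.-tuple R -> R) :
  a <= b -> 0 <= L -> Mclass a b L rho -> cross_ratio (expR (L / 2)) rho.
Proof.
move=> ab L0 [_ _ rho0 H] i j ij t p p' q q'.
have [HV Hth] := H i.
have V1 := HV (ins j q t); have V2 := HV (ins j q' t).
have Z1 := cond_dens_gt0 rho0 V1; have Z2 := cond_dens_gt0 rho0 V2.
have := Hth j (ins j q t) (ins j q' t).
rewrite eq_sym ij => /(_ isT) h.
have {}h : theta_a b (cond_dens rho i (ins j q t))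
    (cond_dens rho i (ins j q' t)) <= L / 2.
  apply: (le_trans (h _)).
    by move=> k kj; rewrite !tnth_ins (negbTE kj).
  by rewrite -(mul1r (_^-1)) ler_wpM2l// tdist_le_half.
have clear_denom (u v x y z1 z2 K : R) : 0 < z1 -> 0 < z2 ->
    u / z2 * (v / z1) <= K * (x / z1 * (y / z2)) -> v * u <= K * (x * y).
  move=> z1_gt0 z2_gt0 le; have := ler_wpM2r (ltW (mulr_gt0 z1_gt0 z2_gt0)) le.
  have -> : u / z2 * (v / z1) * (z1 * z2) = v * u by field; rewrite !gt_eqF.
  suff -> : K * (x / z1 * (y / z2)) * (z1 * z2) = K * (x * y) by [].
  by field; rewrite !gt_eqF.
exact: clear_denom Z1 Z2 (theta_a_ratio ab V1 V2 h p' p).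
Qed.

(** Pass from [t] to [s] through the hybrids [h k], which take their first [k] coordinates from [s]
    and the others from [t]. *)
Lemma tuple_osc n (f : n.-tuple R -> R) (c : R) :
  (forall i x y t, f (ins i x t) <= f (ins i y t) + c) ->
  forall s t, f s <= f t + n%:R * c.
Proof.
move=> osc s t.
pose h k : n.-tuple R :=
  [tuple (if (i < k)%N then tnth s i else tnth t i) | i < n].
have step k : (k <= n)%N -> f (h k) <= f t + k%:R * c.
  elim: k => [_|k IH kn].
    rewrite mul0r addr0 (_ : h 0 = t)//.
    by apply: eq_from_tnth => i; rewrite tnth_mktuple.
  have -> : h k.+1 = ins (Ordinal kn) (tnth s (Ordinal kn)) (h k).
    apply: eq_from_tnth => i; rewrite tnth_ins !tnth_mktuple ltnS leq_eqVlt.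
    by rewrite -val_eqE /=; case: eqP => // ik; congr tnth; exact: val_inj.
  rewrite (le_trans (osc _ _ (tnth (h k) (Ordinal kn)) _))// ins_tnth.
  by have := IH (ltnW kn); rewrite -natr1 mulrDl mul1r; lra.
rewrite -[X in f X <= _](_ : h n = s); first exact: step.
by apply: eq_from_tnth => i; rewrite tnth_mktuple ltn_ord.
Qed.

(** In each coordinate [ln rho] differs from the logarithm of a conditional density by a constant,
    so it oscillates by at most [a]; changing all coordinates costs at most [n * a]. *)
Lemma Mclass_bounds n (a b L : R) (rho : n.-tuple R -> R) :
  Mclass a b L rho -> exists2 m, 0 < m & exists M, forall t, m <= rho t <= M.
Proof.
move=> [_ _ rho0 H].
have osc i x y t : ln (rho (ins i x t)) <= ln (rho (ins i y t)) + a.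
  have [HV _] := H i.
  have Z0 := cond_dens_gt0 rho0 (HV t).
  have := Vset_log_lip x y (HV t).
  by rewrite /cond_dens !ln_div ?posrE//; lra.
have B := @tuple_osc n (fun t => ln (rho t)) a osc.
pose o : n.-tuple R := [tuple 0 | _ < n].
exists (expR (ln (rho o) - n%:R * a)); first exact: expR_gt0.
exists (expR (ln (rho o) + n%:R * a)) => t.
rewrite -[rho t]lnK ?posrE// !ler_expR B andbT.
by have := B o t; lra.
Qed.
End Mclass_theory.

(** * Measurability of continuous functions of a tuple *)

Section measurability.
Context {R : realType}.

(** The preimage of an open ray is the union of the boxes it contains that have a rational centre
    and radius [1/(m+1)], and there are countably many of these. *)
Lemma contN_measurable n (f : n.-tuple R -> R) :
  contN f -> measurable_fun [set: n.-tuple R] f.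
Proof.
move=> cf; apply: (measurability _ (RGenOInfty.measurableE R)) => _ [_ [c ->] <-].
rewrite setTI; set U := _ @^-1` _.
pose box (qm : n.-tuple rat * nat) : set (n.-tuple R) :=
  \bigcap_(j in [set: 'I_n])
    [set t | `|tnth t j - ratr (tnth qm.1 j)| < qm.2.+1%:R^-1].
(* The second factor is everything or empty; it discards the boxes not inside [U] while the index
   runs over a whole countable type. *)
rewrite (_ : U = \bigcup_qm (box qm `&` [set _ | box qm `<=` U])).
  apply: countable_bigcupT_measurable; first exact: countableP.
  move=> qm; have mbox : measurable (box qm).
    apply: fin_bigcap_measurable; first exact: finite_finset.
    move=> j _; pose h (t : n.-tuple R) := `|tnth t j - ratr (tnth qm.1 j)|.
    have mh : measurable_fun setT h.
      apply: measurableT_comp => //; apply: measurable_funB => //.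
      exact: measurable_tnth.
    rewrite (_ : [set t | _] = h @^-1` `]-oo, qm.2.+1%:R^-1[); last first.
      by apply/seteqP; split => t /=; rewrite in_itv.
    by rewrite -[X in measurable X]setTI; exact: mh.
  have [sub|nsub] := pselect (box qm `<=` U).
    by rewrite (_ : [set _ | _] = setT) ?setIT//; apply/seteqP; split.
  by rewrite (_ : [set _ | _] = set0) ?setI0//; apply/seteqP; split.
apply/seteqP; split => [t Ut|t [qm _ [tq sub]]]; last exact: sub.
have e0 : 0 < f t - c by move: Ut; rewrite /U /= in_itv /= andbT subr_gt0.
have [d d0 fd] := cf t _ e0.
have [m md] : exists m : nat, m.+1%:R^-1 < d / 2.
  have d20 : 0 < d / 2 by rewrite divr_gt0.
  exists (Num.truncn (d / 2)^-1); rewrite invf_plt ?posrE//.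
  exact: truncnS_gt.
have /choice[q qP] : forall j : 'I_n, exists q : rat,
    `|tnth t j - ratr q| < m.+1%:R^-1.
  move=> j; have : tnth t j < tnth t j + m.+1%:R^-1 by rewrite ltrDl invr_gt0.
  move=> /rat_in_itvoo[q]; rewrite in_itv /= => /andP[q1 q2].
  by exists q; rewrite distrC gtr0_norm ?subr_gt0// ltrBlDl.
exists ([tuple q j | j < n], m) => //; split.
  by move=> j _ /=; rewrite tnth_mktuple.
move=> t' bt'; rewrite /U /= in_itv /= andbT.
have : `|f t' - f t| < f t - c.
  apply: fd => j; have := bt' j Logic.I; rewrite /= tnth_mktuple.
  have := qP j; rewrite distrC => h1 h2.
  rewrite -(subrK (ratr (q j)) (tnth t' j)) -addrA.
  rewrite (le_lt_trans (ler_normD _ _))// (splitr d) ltrD//.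
    exact: lt_trans md.
  exact: lt_trans md.
by rewrite ltr_norml => /andP[h _]; lra.
Qed.
End measurability.

(** * Positive linear functionals that agree on indicators *)

Section positive_functionals.
Context {d} {T : measurableType d} {R : realType}.

(** The sum counts the integers from 1 to [k] that are at most [y], so it is the integer part of
    [y]. *)
Lemma sum_threshold_bounds (k : nat) (y : R) : 0 <= y <= k%:R ->
  y - 1 <= \sum_(j < k) (j.+1%:R <= y)%R%:R <= y.
Proof.
move=> /andP[y0 yk]; apply/andP; split.
  elim: k yk => [|k IH] yk; first by rewrite big_ord0; lra.
  rewrite big_ord_recr /=; have [yk'|ky] := leP y k%:R.
    by rewrite (le_trans (IH yk'))// lerDl.
  rewrite (eq_bigr (fun=> 1)) => [|j _].
    rewrite sumr_const card_ord; move: yk; rewrite -natr1 => yk.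
    by apply: (@le_trans _ _ k%:R); [lra | rewrite lerDl].
  by rewrite (le_trans _ (ltW ky)) ?ler_nat.
elim: k {yk} => [|k IH]; first by rewrite big_ord0.
rewrite big_ord_recr /=; have [ky|yk] := leP k.+1%:R y; last by rewrite addr0.
apply: le_trans ky; rewrite -natr1 lerD2r.
have -> : k%:R = \sum_(j < k) 1 :> R by rewrite sumr_const card_ord.
apply: ler_sum => j _.
by case: (j.+1%:R <= y).
Qed.

Variables I1 I2 : (T -> R) -> R.
Hypothesis I1D : forall f g, bmf f -> bmf g ->
  I1 (fun x => f x + g x) = I1 f + I1 g.
Hypothesis I2D : forall f g, bmf f -> bmf g ->
  I2 (fun x => f x + g x) = I2 f + I2 g.
Hypothesis I1Z : forall c f, bmf f -> I1 (fun x => c * f x) = c * I1 f.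
Hypothesis I2Z : forall c f, bmf f -> I2 (fun x => c * f x) = c * I2 f.
Hypothesis le_I1 : forall f g, bmf f -> bmf g -> (forall x, f x <= g x) ->
  I1 f <= I1 g.
Hypothesis le_I2 : forall f g, bmf f -> bmf g -> (forall x, f x <= g x) ->
  I2 f <= I2 g.
Hypothesis I12 : forall E, measurable E -> I1 (\1_E) = I2 (\1_E).

Let I12_cst c : I1 (fun=> c) = I2 (fun=> c).
Proof.
have e : (fun=> c) = (fun x : T => c * \1_(@setT T) x).
  by apply/funext => x; rewrite indicT mulr1.
have b1 : bmf (\1_(@setT T) : T -> R) by exact: bmf_indic.
by rewrite e I1Z// I2Z// I12.
Qed.

Let I12_sum k (E : nat -> set T) : (forall j, measurable (E j)) ->
  bmf (fun x => \sum_(j < k) \1_(E j) x : R) /\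
  I1 (fun x => \sum_(j < k) \1_(E j) x) = I2 (fun x => \sum_(j < k) \1_(E j) x).
Proof.
move=> mE; elim: k => [|k [bk IH]].
  rewrite (_ : (fun x => _) = fun=> 0); first by split; [exact: bmf_cst|].
  by apply/funext => x; rewrite big_ord0.
have bE : bmf (\1_(E k) : T -> R) by exact: bmf_indic.
rewrite (_ : (fun x => _) = fun x => \sum_(j < k) \1_(E j) x + \1_(E k) x).
  by split; [exact: bmfD | rewrite I1D// I2D// IH I12].
by apply/funext => x; rewrite big_ord_recr.
Qed.

(** The average [S] of the indicators of [k + 1] superlevel sets is within [1/(k+1)] of [h], and
    both functionals agree on it. Hence they differ on [h] by at most [c/(k+1)] for every [k]. *)
Let I12_01 h : bmf h -> (forall x, 0 <= h x <= 1) -> I1 h = I2 h.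
Proof.
move=> bh h01; pose c := I1 (fun=> 1).
have close k : `|I1 h - I2 h| <= k.+1%:R^-1 * c.
  pose E j := [set x | j.+1%:R <= k.+1%:R * h x].
  have mE j : measurable (E j).
    pose hk x := k.+1%:R * h x.
    have mh : measurable_fun setT hk.
      by apply: measurable_funM; [exact: measurable_cst|case: bh].
    rewrite (_ : E j = hk @^-1` `[j.+1%:R, +oo[); last first.
      by apply/seteqP; split => x /=; rewrite in_itv /= andbT.
    by rewrite -[X in measurable X]setTI; exact: mh.
  have [bS eS] := I12_sum k.+1 mE.
  pose S x : R := k.+1%:R^-1 * \sum_(j < k.+1) \1_(E j) x.
  have bS' : bmf S by apply: bmfM => //; exact: bmf_cst.
  have eS' : I1 S = I2 S by rewrite I1Z// I2Z// eS.
  have k0 : 0 < k.+1%:R :> R by [].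
  have Sh x : S x <= h x <= S x + k.+1%:R^-1.
    have := @sum_threshold_bounds k.+1 (k.+1%:R * h x).
    have /andP[h0 h1] := h01 x.
    rewrite mulr_ge0//= ler_piMr// => /(_ isT).
    rewrite (_ : \sum_(j < _) _ = k.+1%:R * S x); last first.
      rewrite /S mulrA divff ?mul1r ?gt_eqF//; apply: eq_bigr => j _.
      by rewrite indicE; congr (nat_of_bool _)%:R; apply/idP/idP; rewrite inE.
    move=> /andP[l1 l2]; rewrite -(ler_pM2l k0) l2 /=.
    by rewrite -(ler_pM2l k0) mulrDr divff ?gt_eqF// -lerBlDr.
  have bS1 : bmf (fun x => S x + k.+1%:R^-1).
    by apply: bmfD => //; exact: bmf_cst.
  have cst1 : I1 (fun=> k.+1%:R^-1) = k.+1%:R^-1 * c.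
    rewrite -I1Z; last exact: bmf_cst.
    by congr I1; apply/funext => x; rewrite mulr1.
  have l1 : I1 S <= I1 h by apply: le_I1 => // x; have /andP[] := Sh x.
  have l2 : I2 S <= I2 h by apply: le_I2 => // x; have /andP[] := Sh x.
  have l3 : I1 h <= I1 S + k.+1%:R^-1 * c.
    rewrite -cst1 -I1D//; last exact: bmf_cst.
    by apply: le_I1 => // x; have /andP[] := Sh x.
  have l4 : I2 h <= I2 S + k.+1%:R^-1 * c.
    rewrite -cst1 I12_cst -I2D//; last exact: bmf_cst.
    by apply: le_I2 => // x; have /andP[] := Sh x.
  rewrite -eS' in l2 l4.
  move: (I1 S) (I1 h) (I2 h) (_ * c) l1 l2 l3 l4 => s h1 h2 e l1 l2 l3 l4.
  by rewrite ler_norml; lra.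
apply/eqP; rewrite -subr_eq0 -normr_le0 leNgt; apply/negP => D0.
have c0 : 0 <= c by have := close 0; rewrite invr1 mul1r; exact: le_trans.
have := close (Num.truncn (c / `|I1 h - I2 h|)).
rewrite ler_pdivlMl// leNgt -ltr_pdivrMr// truncnS_gt//.
Qed.

Lemma bmf_functional_eq f : bmf f -> I1 f = I2 f.
Proof.
move=> bf; have [mf [B fB]] := bf.
have B0 : 0 <= B by exact: le_trans (fB point).
(* The values of [f + B] lie in [[0, 2 B]]; the extra 1 keeps [c] positive when [B = 0]. *)
pose c := 2 * B + 1; have c0 : 0 < c by rewrite /c; lra.
pose h x := c^-1 * (f x + B).
have bh : bmf h.
  by apply: bmfM; [exact: bmf_cst|apply: bmfD => //; exact: bmf_cst].
have h01 x : 0 <= h x <= 1.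
  have := fB x; rewrite ler_norml => /andP[l1 l2].
  by rewrite /h mulr_ge0 ?invr_ge0 ?(ltW c0)//= ?ler_pdivrMl// /c; lra.
have -> : f = (fun x => c * h x + - B).
  by apply/funext => x; rewrite /h mulrA divff ?gt_eqF// mul1r addrK.
have bch : bmf (fun x => c * h x) by apply: bmfM => //; exact: bmf_cst.
have bB : bmf (fun _ : T => - B) by exact: bmf_cst.
by rewrite I1D// I2D// I12_cst I1Z// I2Z// I12_01.
Qed.

End positive_functionals.

(** * Expectations as iterated integrals, and the one-sided tail bound *)

Section tail.
Context {R : realType}.

Lemma probability_bmf_integrable {d} {T : measurableType d}
  (P : probability T R) (f : T -> R) : bmf f -> P.-integrable setT (EFin \o f).
Proof.
move=> [mf [B fB]]; apply: measurable_bounded_integrable => //.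
- by rewrite [X in (X < _)%E]probability_setT ltry.
- exists B; split; first exact: num_real.
  by move=> M BM x _; exact: le_trans (fB x) (ltW BM).
Qed.

(** The density hypothesis speaks of sets only; it extends to bounded functions because both sides
    are positive linear functionals of [g]. *)
Lemma expectation_iterR n (rho : n.-tuple R -> R)
    (mu : probability (n.-tuple R) R) :
  bmf rho -> (forall t, 0 < rho t) ->
  (forall E : set (n.-tuple R), measurable E ->
     mu E = iterint (fun t => ((\1_E t : R) * rho t)%:E)) ->
  forall g, bmf g ->
  fine (\int[mu]_y (g y)%:E)%E = iterR (fun t => g t * rho t).
Proof.
move=> brho rho0 muE g bg.
apply: (@bmf_functional_eq _ _ _ (fun f => fine (\int[mu]_y (f y)%:E)%E)
    (fun f => iterR (fun t => f t * rho t))) => //.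
- move=> f h /(probability_bmf_integrable mu) If /(probability_bmf_integrable mu) Ih.
  exact: (RintegralD (mu := mu)).
- move=> f h bf bh; rewrite -iterRD; [|by bmf_tac|by bmf_tac].
  by congr iterR; apply/funext => t; rewrite mulrDl.
- move=> c f /(probability_bmf_integrable mu) If.
  exact: (RintegralZl (mu := mu)).
- move=> c f bf; rewrite -iterRZl; last by bmf_tac.
  by congr iterR; apply/funext => t; rewrite mulrA.
- move=> f h /(probability_bmf_integrable mu) If /(probability_bmf_integrable mu) Ih fh.
  exact: (le_Rintegral (mu := mu)).
- move=> f h bf bh fh; apply: le_iterR; [by bmf_tac|by bmf_tac|move=> t].
  by rewrite ler_wpM2r// ltW.
- move=> E mE; rewrite integral_indic// setIT [X in fine X]muE//.
  rewrite iterint_iterR//; apply: bmfM => //; exact: bmf_indic.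
Qed.

(** The left side dominates the probability of an upper deviation by [eps]. With the final
    oscillation [C = 141/100 / n], the exponent [- lam * eps + lam^2 * n * C^2 / 8] is nearly
    minimal at [lam = 2 n eps]. *)
Lemma chernoff_iterR n (rho g : n.-tuple R -> R) (b eps : R) :
  (10 <= n)%N -> 0 < b -> (forall t, b <= rho t) -> bmf rho -> bmf g ->
  iterR rho = 1 -> 0 < eps ->
  cross_ratio (1 + (2 * n%:R - 1)^-1) rho ->
  (forall j t x y, g (ins j x t) <= g (ins j y t) + n%:R^-1) ->
  iterR (fun t => expR (2 * n%:R * eps *
    (g t - iterR (fun t => g t * rho t) - eps)) * rho t) <=
  expR (- (eps ^+ 2 * n%:R)).
Proof.
move=> n10 b0 brho mrho mg rho1 eps0 cr osc.
set m := iterR (fun t => g t * rho t); set lam := 2 * n%:R * eps.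
have nge : 10 <= n%:R :> R by rewrite ler_nat.
have n0 : 0 < n%:R :> R by lra.
have lam0 : 0 <= lam by rewrite !mulr_ge0// ltW.
have := @mgf_bound _ n rho g b n%:R^-1 (141 / 100 * n%:R^-1) lam (2 * n%:R - 1)
  b0 brho mrho mg _ lam0 _ _ cr osc.
rewrite invr_gt0 n0 rho1 divr1 mul1r -/m => H.
have {}H : iterR (fun t => expR (lam * g t) * rho t) <=
    expR (lam * m + lam ^+ 2 * (n%:R * ((141 / 100 * n%:R^-1) ^+ 2 / 8))).
  apply: H => //; first lra.
  (* This is [2 n - 1 <= 141/100 * (29/20 * n - 1)], true from [n = 10] on; here the threshold is
     decided. *)
  rewrite [leRHS]mulrAC [leRHS]mulrC ler_pM2l ?invr_gt0//; lra.
rewrite (_ : (fun t => _) =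
    (fun t => expR (- lam * (m + eps)) * (expR (lam * g t) * rho t))); last first.
  by apply/funext => t; rewrite mulrA -expRD; congr (expR _ * _); ring.
rewrite iterRZl; last by bmf_tac.
rewrite (le_trans (ler_wpM2l (expR_ge0 _) H))// -expRD ler_expR.
(* The constant is [4 * (141/100)^2 / 8], just below 1, and stands against the [- 2] coming from
   [- lam * eps]. *)
have -> : lam ^+ 2 * (n%:R * ((141 / 100 * n%:R^-1) ^+ 2 / 8)) =
   19881 / 20000 * (eps ^+ 2 * n%:R).
  by rewrite /lam; field; rewrite gt_eqF.
have -> : - lam * (m + eps) = - (lam * m) - 2 * (eps ^+ 2 * n%:R).
  by rewrite /lam; ring.
have : 0 <= eps ^+ 2 * n%:R by rewrite mulr_ge0 ?sqr_ge0.
lra.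
Qed.

End tail.

(** * The two-sided concentration inequality *)

Unset Implicit Arguments.

Theorem theorem3 (R : realType) (a b : R) :
  0 < a -> a <= b ->
  exists A : R, 0 < A /\ exists N0 : nat, forall N : nat, (N0 <= N)%N ->
  forall (rho : N.-tuple R -> R) (mu : probability (N.-tuple R) R),
    Mclass a b (N%:R^-1) rho ->
    (* mu is the measure on T^N = [0,1]^N with density rho *)
    (forall E : set (N.-tuple R), measurable E ->
       mu E = iterint (fun t => ((\1_E t : R) * rho t)%:E)) ->
  forall g : N.-tuple R -> R,
    (* g in O_{N^-1}(T^N) *)
    periodicN g -> measurable_fun [set: N.-tuple R] g ->
    (iterint (fun t => (`|g t|)%:E) < +oo)%E ->
    (forall j : 'I_N, (Osc j g <= (N%:R^-1)%:E)%E) ->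
  forall eps : R, 0 < eps ->
    (mu [set x | (eps <= `|g x - fine (\int[mu]_y (g y)%:E)%E|)%R]
      <= (2 * expR (- (eps ^+ 2 * N%:R) / (1 + A * N%:R^-1) ^+ 2))%:E)%E.
Proof.
move=> a0 ab; exists 1; split=> //; exists 10 => N N10 rho mu Mrho muE g _ mg _.
move=> oscg eps eps0.
have Nge : 10 <= N%:R :> R by rewrite ler_nat.
have N0 : 0 < N%:R :> R by lra.
have [_ [crho _] rho0 _] := Mrho.
have [l l0 [u lu]] := Mclass_bounds Mrho.
have lrho t : l <= rho t by have /andP[] := lu t.
have brho : bmf rho.
  split; first exact: contN_measurable.
  by exists u => t; rewrite gtr0_norm//; have /andP[] := lu t.
have osc j t x y : g (ins j x t) <= g (ins j y t) + N%:R^-1.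
  rewrite -lerBlDl (le_trans (ler_norm _))// -lee_fin (le_trans _ (oscg j))//.
  by apply: ereal_sup_ubound; exists x, y, t.
have bg : bmf g.
  (* [N] coordinates with oscillation [1/N] each give a total oscillation of at most 1. *)
  split=> //; have B := @tuple_osc _ _ g _ (fun i x y t => osc i t x y).
  pose o : N.-tuple R := [tuple 0 | _ < N].
  exists (`|g o| + 1) => t; have := B t o; have := B o t.
  rewrite divff ?gt_eqF// => l1 l2.
  have := ler_norm (g o); have := ler_norm (- g o); rewrite normrN ler_norml.
  lra.
have mrho0 t : 0 <= rho t by exact: ltW.
have rho1 : iterR rho = 1.
  apply: EFin_inj; rewrite -iterint_iterR// -(@probability_setT _ _ _ mu) muE//.
  by congr iterint; apply/funext => t; rewrite indicT mul1r.
have cr : cross_ratio (1 + (2 * N%:R - 1)^-1) rho.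
  have L0 : 0 <= N%:R^-1 :> R by rewrite invr_ge0 ltW.
  apply: cross_ratio_le (Mclass_cross_ratio ab L0 Mrho) => //.
  (* With [x = 1/(2N)], the inequality [1 - x <= expR (- x)] gives
     [expR x <= 1/(1 - x) = 1 + 1/(2N - 1)]. *)
  have -> : N%:R^-1 / 2 = - - (2 * N%:R)^-1 :> R by rewrite opprK invfM mulrC.
  rewrite expRN -(_ : (1 - (2 * N%:R)^-1)^-1 = 1 + (2 * N%:R - 1)^-1 :> R).
    have x1 : (2 * N%:R)^-1 < 1 :> R by rewrite invf_lt1; lra.
    by rewrite lef_pV2 ?posrE ?expR_gt0 ?subr_gt0// expR_ge1Dx.
  by field; rewrite !gt_eqF//; lra.
rewrite (expectation_iterR brho rho0 muE bg).
set m := iterR _; set S := [set x | _].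
have mS : measurable S.
  pose h x := `|g x - m|.
  have mh : measurable_fun setT h.
    by apply: measurableT_comp => //; apply: measurable_funB.
  rewrite (_ : S = h @^-1` `[eps, +oo[); last first.
    by apply/seteqP; split => x /=; rewrite in_itv /= andbT.
  by rewrite -[X in measurable X]setTI; exact: mh.
have bS : bmf (fun t => \1_S t * rho t) by apply: bmfM => //; exact: bmf_indic.
rewrite [leLHS]muE// iterint_iterR// lee_fin.
have up := chernoff_iterR N10 l0 lrho brho bg rho1 eps0 cr osc.
have bNg : bmf (fun t => - g t) by exact: bmfN.
have oscN j t x y : - g (ins j x t) <= - g (ins j y t) + N%:R^-1.
  by have := osc j t y x; lra.
have dn := chernoff_iterR N10 l0 lrho brho bNg rho1 eps0 cr oscN.
have mN : iterR (fun t => - g t * rho t) = - m.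
  rewrite -mulN1r -iterRZl; last by bmf_tac.
  by congr iterR; apply/funext => t; rewrite mulN1r mulNr.
rewrite mN -/m in up dn; set lam := 2 * N%:R * eps in up dn.
have lam0 : 0 <= lam by rewrite !mulr_ge0// ltW.
(* The indicator of [S] is at most the sum of the exponentials for [g] and [- g]: whichever
   deviation occurs has a nonnegative exponent. *)
apply: (@le_trans _ _ (expR (- (eps ^+ 2 * N%:R)) + expR (- (eps ^+ 2 * N%:R)))).
  apply: le_trans (lerD up dn); rewrite -iterRD; [|by bmf_tac|by bmf_tac].
  apply: le_iterR => //; first by bmf_tac.
  move=> t; rewrite -mulrDl ler_wpM2r// indicE.
  have [|_] := boolP (t \in S); last by rewrite addr_ge0 ?expR_ge0.
  rewrite inE /S /= => epsg; have [gm|gm] := leP 0 (g t - m).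
    rewrite ger0_norm// in epsg; rewrite ler_wpDr ?expR_ge0//.
    by rewrite -expR0 ler_expR mulr_ge0// subr_ge0.
  rewrite ltr0_norm// in epsg; rewrite ler_wpDl ?expR_ge0//.
  by rewrite -expR0 ler_expR mulr_ge0//; lra.
have e2 : 0 <= eps ^+ 2 * N%:R by rewrite mulr_ge0 ?sqr_ge0// ltW.
have d1 : 1 <= (1 + 1 * N%:R^-1) ^+ 2 :> R.
  by rewrite expr_ge1// lerDl mul1r invr_ge0 ltW.
(* The divisor is at least 1, so dividing the exponent by it only weakens the bound. *)
have le : expR (- (eps ^+ 2 * N%:R)) <=
    expR (- (eps ^+ 2 * N%:R) / (1 + 1 * N%:R^-1) ^+ 2).
  by rewrite ler_expR mulNr lerN2 ler_pdivrMr ?(lt_le_trans ltr01 d1)// ler_peMr.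
by rewrite mulrDl ![1 * expR _]mul1r; exact: lerD.
Qed.
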